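(* Fix any constant $c\ge1$. Let $\beta\in[0,1)$, $\gamma=1-\beta$ and $k\le n$. In the synchronous point-to-point Data Retrieval model with $k$ peers, an $n$-bit source and a dynamic Byzantine adversary corrupting at most $\beta k$ peers in each round ($\beta$ known to the peers), there is a 2-round randomized algorithm for Download, succeeding with probability at least $1-n^{-c}$, with query complexity $$\mathcal Q=O\!\left(\frac{n\log n}{\gamma k}+\sqrt{\frac n\gamma}\right)$$ and message size $O\!\left(\frac{n}{\gamma k}\log n+\sqrt{\frac n\gamma}\right)$ bits. (The hidden constants may depend on $c$ but not on $n,k,\beta$.)
   Context: Data Retrieval (DR) model. There are $k$ peers with unique IDs $1,\dots,k$ forming a complete network, and a trusted read-only external source storing an array $X=(b_1,\dots,b_n)\in\{0,1\}^n$, with $n\ge k$. A query $\mathrm{Query}(i)$ by a peer to the source returns $b_i$. Synchronous rounds: each round has three sub-rounds: (1) each peer sends any number (between $0$ and $n$) of queries to the source; (2) the source answers all of them; (3) peers exchange messages, delivered within the round. Point-to-point communication: a peer may send a different message to each other peer; the receiver knows the sender's ID. Local computation is free and instantaneous. Dynamic Byzantine adversary: at the start of each round the adversary chooses, arbitrarily and adaptively, the set of at most $\beta k$ peers that are Byzantine (corrupted) in that round; a peer may be Byzantine in one round and nonfaulty in the next. Byzantine peers behave arbitrarily in that round; the other peers follow the protocol in that round, using the messages delivered to them so far. The adversary chooses $X$. Peers generate private local random bits. At the beginning of round $t$ the adversary knows $X$, all local random bits generated up to round $t-1$ and all communication up to round $t-1$. Download problem: every peer that is nonfaulty when outputting must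 output an array equal to $X$; the algorithm succeeds if this holds. Complexity measures: $\mathcal Q$ = maximum number of bits queried by a peer while nonfaulty; message size = maximum number of bits in one message sent by a nonfaulty peer. *)

(* Defs.v *)
From mathcomp Require Import all_boot all_order all_algebra.
From mathcomp Require Import reals exp.

Set Implicit Arguments.
Unset Strict Implicit.
Unset Printing Implicit Defensive.

Import Order.TTheory GRing.Theory Num.Theory.
Local Open Scope ring_scope.

(* Synchronous Data Retrieval model: k peers, an n-bit source, and r private
   random bits per peer and per round. *)

Section Model.
Variables n k r : nat.

Definition coin := r.-tuple bool.

(* One peer's query answers in a round; [None] marks an index not queried. *)
Definition answers := {ffun 'I_n -> option bool}.

(* A message is a bit string; the empty string stands for silence. *)
Definition message := seq bool.

(* What one peer holds about one past round: its private memory of its own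
   random bits and query answers, and the message delivered by each sender. *)
Record local_round := LocalRound {
  own_coin : coin;
  own_answers : answers;
  inbox : 'I_k -> message
}.

(* All the past rounds of one peer, oldest first; its size is the number of
   completed rounds, so a protocol can depend on the round number. *)
Definition view := seq local_round.

(* Within a round all queries are issued before any of them is answered, and
   messages are sent after the answers have arrived. *)
Record protocol := Protocol {
  ask : 'I_k -> view -> coin -> {set 'I_n};
  send : 'I_k -> view -> coin -> answers -> 'I_k -> message;
  decide : 'I_k -> view -> n.-tuple bool
}.

(* The random bits drawn by all the peers in one round. *)
Definition coins := {ffun 'I_k -> coin}.

Record round_record := RoundRecord {
  corrupted : {set 'I_k};
  drawn : coins;
  queried : 'I_k -> {set 'I_n};      (* by nonfaulty peers *)
  memory : 'I_k -> coin * answers;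
  traffic : 'I_k -> 'I_k -> message  (* sender, then receiver *)
}.

Definition transcript := seq round_record.

(* The adversary knows the source, which it chooses, and the transcript of the
   previous rounds.  The set corrupted in a round is a function of these only.
   The behaviour of the corrupted peers is arbitrary: it may also depend on the
   random bits drawn in the current round (hence on the messages the nonfaulty
   peers are sending), and a peer may be left with an arbitrary private memory
   of a round in which it was corrupted.  Queries of corrupted peers are not
   represented, since the adversary knows the source. *)
Record adversary := Adversary {
  source : n.-tuple bool;
  corrupt : transcript -> {set 'I_k};
  fake_message : transcript -> coins -> 'I_k -> 'I_k -> message;
  fake_memory : transcript -> coins -> 'I_k -> coin * answers
}.

Definition answer (X : n.-tuple bool) (S : {set 'I_n}) : answers :=
  [ffun j => if j \in S then Some (tnth X j) else None].

Definition local_view (h : transcript) (i : 'I_k) : view :=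
  [seq LocalRound (memory rec i).1 (memory rec i).2 (fun j => traffic rec j i)
    | rec <- h].

Definition play_round (P : protocol) (A : adversary) (h : transcript)
    (c : coins) : round_record :=
  let B := corrupt A h in
  let Q i := ask P i (local_view h i) (c i) in
  let ans i := answer (source A) (Q i) in
  {| corrupted := B;
     drawn := c;
     queried := fun i => if i \in B then set0 else Q i;
     memory := fun i => if i \in B then fake_memory A h c i else (c i, ans i);
     traffic := fun i j =>
       if i == j then [::]
       else if i \in B then fake_message A h c i j
       else send P i (local_view h i) (c i) (ans i) j |}.

Definition run (P : protocol) (A : adversary) (w : seq coins) : transcript :=
  foldl (fun h c => rcons h (play_round P A h c)) [::] w.

(* Outputs are produced at the end of the last round. *)
Definition nonfaulty_at_end (h : transcript) (i : 'I_k) : bool :=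
  i \notin last set0 [seq corrupted rec | rec <- h].

Definition downloads (P : protocol) (A : adversary) (w : seq coins) : bool :=
  let h := run P A w in
  [forall i : 'I_k, nonfaulty_at_end h i ==>
     (decide P i (local_view h i) == source A)].

Definition query_count (h : transcript) (i : 'I_k) : nat :=
  (\sum_(rec <- h) #|queried rec i|)%N.

Definition max_message_size (h : transcript) : nat :=
  (\max_(rec <- h) \max_(i : 'I_k | i \notin corrupted rec)
     \max_(j : 'I_k) size (traffic rec i j))%N.

End Model.

Section Measures.
Variables (R : realType) (n k r : nat).

Definition admissible (beta : R) (A : adversary n k r) : Prop :=
  forall h, #|corrupt A h|%:R <= beta * k%:R.

(* Probability over independent uniform random bits for all peers and all of
   the T rounds. *)
Definition success_probability (T : nat) (P : protocol n k r)
    (A : adversary n k r) : R :=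
  #|[set w : T.-tuple (coins k r) | downloads P A w]|%:R
    / #|{: T.-tuple (coins k r)}|%:R.

Definition query_complexity_at_most (T : nat) (beta : R)
    (P : protocol n k r) (q : R) : Prop :=
  forall A, admissible beta A -> forall (w : T.-tuple (coins k r)) (i : 'I_k),
    (query_count (run P A w) i)%:R <= q.

Definition message_size_at_most (T : nat) (beta : R)
    (P : protocol n k r) (m : R) : Prop :=
  forall A, admissible beta A -> forall w : T.-tuple (coins k r),
    (max_message_size (run P A w))%:R <= m.

End Measures.

(* Main.v *)
(* Cut the source into K = 2^r segments, where K is about
   min(sqrt(n gamma), gamma k / (4 (c + 1) ln n)).  In round 1 every peer queries
   a uniformly random segment and sends it to everybody.  The corrupted set of
   round 1 cannot depend on these choices, so by a Chernoff bound every segment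
   is sent by more than t ~ gamma k / (4 K) nonfaulty peers, except with
   probability n^-c.  In round 2 a peer keeps, for each segment, the strings it
   received at least t times: the true string is among them, and altogether
   there are at most k / t = O(K / gamma) candidates.  A family of m strings is
   separated by at most m positions, so O(sqrt(n / gamma)) further queries single
   out the true strings; only messages, never the possibly corrupted private
   memory, are used from round 1.  When gamma k < 4 (c + 1) ln n or n = 1, the
   bound is of order n and each peer queries the whole source in round 2. *)

Require Import Defs.
From mathcomp Require Import all_boot all_order all_algebra.
From mathcomp Require Import reals sequences exp ring lra.
Import Order.TTheory GRing.Theory Num.Theory.
Local Open Scope ring_scope.
Set Implicit Arguments.
Unset Strict Implicit.
Unset Printing Implicit Defensive.

(** * Separating a family of sets by few points *)

Section Separation.
Variable T : finType.
Implicit Types (A D : {set T}) (F : {set {set T}}).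

Definition separates F D : bool := dinjectiveb (fun A => A :&: D) (mem F).

(* A new set A is confused by the old separating set with at most one member
   of the family, and one further point tells them apart. *)
Lemma separating_set_exists F :
  exists D, (#|D| <= #|F|)%N && separates F D.
Proof.
move eqm: #|F| => m; elim: m F eqm => [|m IHm] F eqm.
  exists set0; rewrite cards0; apply/dinjectiveP => A B.
  by rewrite (cards0_eq eqm) /= inE.
have [A FA] : exists A, A \in F by apply/card_gt0P; rewrite eqm.
have [D /andP[leD /dinjectiveP injD]] :
    exists D, (#|D| <= m)%N && separates (F :\ A) D.
  by apply: IHm; apply: succn_inj; rewrite -eqm (cardsD1 A F) FA.
have [B /andP[FB /eqP eqAB]|noB] :=
    pickP (fun B => (B \in F :\ A) && (A :&: D == B :&: D)); last first.
  exists D; rewrite (leq_trans leD (leqnSn m)); apply/dinjectiveP => U V FU FV.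
  have [->|neU] := eqVneq U A; have [->|neV] := eqVneq V A => // eqUV.
  - by move: (noB V); rewrite !inE neV FV eqUV eqxx.
  - by move: (noB U); rewrite !inE neU FU eqUV eqxx.
  by apply: injD; rewrite ?inE ?neU ?neV.
have neBA : B != A by move: FB; rewrite !inE => /andP[].
have [x xAB] : exists x, (x \in A) != (x \in B).
  apply/existsP; apply: contraNT neBA; rewrite negb_exists => /forallP eqx.
  by apply/eqP/setP => x; move: (eqx x); rewrite negbK => /eqP.
exists (x |: D); rewrite cardsU1 -addn1 addnC leq_add ?leq_b1 //.
have meetD U V : U :&: (x |: D) = V :&: (x |: D) ->
    U :&: D = V :&: D /\ (x \in U) = (x \in V).
  move=> /setP eqUV; split; last by move: (eqUV x); rewrite !inE eqxx !andbT.
  apply/setP => y; move: (eqUV y); rewrite !inE.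
  by case: (y \in D); rewrite ?orbT // !andbF.
have AV V : V \in F -> A :&: (x |: D) = V :&: (x |: D) -> A = V.
  move=> FV /meetD[eqD eqx]; apply/eqP; apply: contraNT xAB => neAV.
  rewrite eqx (injD V B) ?eqxx // -?eqD //.
  by rewrite !inE eq_sym neAV.
apply/dinjectiveP => U V FU FV.
have [->|neU] := eqVneq U A; first exact: AV.
have [->|neV] := eqVneq V A; first by move/esym/AV => ->.
by move=> /meetD[eqD _]; apply: injD; rewrite ?inE ?neU ?neV.
Qed.

(** A fixed choice, so that querying and decoding recompute the same set from the same inbox. *)
Definition separating_set F : {set T} := xchoose (separating_set_exists F).

Lemma card_separating_set F : (#|separating_set F| <= #|F|)%N.
Proof. by case/andP: (xchooseP (separating_set_exists F)). Qed.

Lemma separating_setP F :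
  {in F &, injective (fun A => A :&: separating_set F)}.
Proof.
by case/andP: (xchooseP (separating_set_exists F)) => _ /dinjectiveP.
Qed.

End Separation.

Lemma card_residue_class n K a :
  (#|[set x : 'I_n | x %% K == a]| <= (n %/ K).+1)%N.
Proof.
set S := finset _; rewrite -[leqRHS]card_ord.
pose q (x : 'I_n) : 'I_(n %/ K).+1 := inord (x %/ K).
have injq : {in S &, injective q}.
  move=> x y; rewrite !inE => /eqP xa /eqP ya /(congr1 val).
  rewrite /= !inordK ?ltnS ?leq_div2r ?(ltnW (ltn_ord _)) // => eqq.
  by apply: val_inj; rewrite /= (divn_eq x K) (divn_eq y K) eqq xa ya.
by rewrite -(card_in_imset injq) max_card.
Qed.

(** * Lower tail for the load of one cell *)

Section Occupancy.
Variables (R : realType) (I S : finType).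

(* Markov's inequality applied to [2 ^ (t - number of hits)]. *)
Lemma lower_tail (G : {set I}) (s : S) (t : nat) :
  #|[set f : {ffun I -> S} | (#|[set j in G | f j == s]| <= t)%N]|%:R
    <= 2 ^+ t * (1 - (2 * #|S|%:R)^-1) ^+ #|G| * #|{ffun I -> S}|%:R :> R.
Proof.
(* Each hit weighs 1/2, so [\prod_j w j (f j)] is 2 to the minus number of hits, and its sum over
   [f] factors over [j]. *)
pose w j c : R := if (j \in G) && (c == s) then 2^-1 else 1.
have Spos : 0 < #|S|%:R :> R by rewrite ltr0n; apply/card_gt0P; exists s.
have wprod (f : {ffun I -> S}) :
    \prod_j w j (f j) = 2^-1 ^+ #|[set j in G | f j == s]|.
  rewrite /w -big_mkcond /= big_const iter_mulr_1.
  by congr (_ ^+ _); apply: eq_card => j; rewrite !inE.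
have wsum j : \sum_c w j c =
    (if j \in G then 1 - (2 * #|S|%:R)^-1 else 1) * #|S|%:R.
  have [jG|jG] := boolP (j \in G); last first.
    rewrite /w (negbTE jG) /= big_const iter_addr_0 mul1r.
    by congr (_%:R); apply: eq_card.
  rewrite /w jG /= (bigD1 s) //= eqxx.
  under eq_bigr => c /negbTE -> do [].
  rewrite sumr_const cardC1 mulrBl mul1r.
  have -> : #|S|.-1%:R = #|S|%:R - 1 :> R by rewrite -subn1 natrB -?(ltr0n R).
  by field; rewrite gt_eqF.
have sumE : \sum_(f : {ffun I -> S}) 2^-1 ^+ #|[set j in G | f j == s]| =
    (1 - (2 * #|S|%:R)^-1) ^+ #|G| * #|{ffun I -> S}|%:R :> R.
  under eq_bigr do rewrite -wprod.
  rewrite -(bigA_distr_bigA w); under eq_bigr do rewrite wsum.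
  rewrite big_split /= -big_mkcond /= !prodr_const.
  by rewrite card_ffun natrX.
rewrite -mulrA -sumE -sum1_card natr_sum mulr_sumr big_mkcond /=.
apply: ler_sum => f _; rewrite inE.
case: leqP => [le_t|_]; last by rewrite mulr_ge0 ?exprn_ge0 ?invr_ge0.
rewrite exprVn ler_pdivlMr ?exprn_gt0 // mul1r.
by rewrite ler_weXn2l // ler1n.
Qed.
End Occupancy.

(** * The segment protocol and its correctness *)

Section SegmentProtocol.
Variables n k r t : nat.

(* The coin a peer draws is the name of the segment it queries. *)
Definition segment (s : coin r) : {set 'I_n} :=
  [set x : 'I_n | x %% 2 ^ r == enum_rank s]%N.

Definition encode (s : coin r) (A : {set 'I_n}) : message :=
  s ++ [seq x \in A | x <- enum (segment s)].

Implicit Types (box : 'I_k -> message) (A X W : {set 'I_n}).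

(** A string on a segment is represented by the set of its ones, so that separating sets apply to
    received strings. *)
Definition candidates box (s : coin r) : {set {set 'I_n}} :=
  [set A : {set 'I_n} | (A \subset segment s)
    && (t <= #|[set j | box j == encode s A]|)%N].

Lemma in_candidates box s A : (A \in candidates box s) =
  (A \subset segment s) && (t <= #|[set j | box j == encode s A]|)%N.
Proof. exact: in_set. Qed.

Definition checked box : {set 'I_n} :=
  \bigcup_(s : coin r) separating_set (candidates box s).

(** [W] holds the ones found among the queried positions; in each segment it selects the candidates
    that agree with it on the separating set. *)
Definition reconstruct box W : {set 'I_n} :=
  [set x | [exists s : coin r, [exists A in candidates box s,
    (x \in A) && (A :&: separating_set (candidates box s)
      == W :&: segment s :&: separating_set (candidates box s))]]].

Definition ones (a : answers n) : {set 'I_n} := [set x | a x == Some true].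

Definition segment_protocol : protocol n k r := {|
  ask := fun _ v c => if v is l :: _ then checked (inbox l) else segment c;
  send := fun _ v c a _ => if v is [::] then encode c (ones a) else [::];
  decide := fun _ v => if v is [:: l1; l2]
    then [tuple x \in reconstruct (inbox l1) (ones (own_answers l2)) | x < n]
    else [tuple of nseq n false] |}.

Lemma card_coin : #|{: coin r}| = (2 ^ r)%N.
Proof. by rewrite card_tuple card_bool. Qed.

Lemma card_segment s : (#|segment s| <= (n %/ 2 ^ r).+1)%N.
Proof. exact: card_residue_class. Qed.

Lemma in_some_segment (x : 'I_n) : exists s, x \in segment s.
Proof.
have ltx : (x %% 2 ^ r < #|{: coin r}|)%N by rewrite card_coin ltn_mod expn_gt0.
by exists (enum_val (Ordinal ltx)); rewrite inE enum_valK.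
Qed.

Lemma size_encode s A : (size (encode s A) <= r + (n %/ 2 ^ r).+1)%N.
Proof.
by rewrite size_cat size_tuple size_map -cardE leq_add2l card_segment.
Qed.

(** The name takes exactly [r] bits and can be split off; the other bits fix the set inside the
    segment, and it is empty outside. *)
Lemma encode_inj s s' A A' : A \subset segment s -> A' \subset segment s' ->
  encode s A = encode s' A' -> s = s' /\ A = A'.
Proof.
move=> sA sA' /eqP; rewrite eqseq_cat ?size_tuple // => /andP[/eqP/val_inj eqs].
subst s' => /eqP/eq_in_map eqA; split=> //; apply/setP => x.
have [xs|xs] := boolP (x \in segment s); first by apply: eqA; rewrite mem_enum.
have out (B : {set 'I_n}) : B \subset segment s -> (x \in B) = false.
  by move=> sB; apply: contraNF xs => /(subsetP sB).
by rewrite !out.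
Qed.

(* Each delivered message votes for at most one candidate. *)
Lemma card_candidates box :
  ((\sum_(s : coin r) #|candidates box s|) * t <= k)%N.
Proof.
pose cand (p : coin r * {set 'I_n}) := p.2 \in candidates box p.1.
have -> : (\sum_(s : coin r) #|candidates box s| = \sum_(p | cand p) 1)%N.
  rewrite -(pair_big_dep xpredT (fun s A => A \in candidates box s)
    (fun _ _ => 1%N)) /=.
  by apply: eq_bigr => s _; rewrite sum1_card.
rewrite big_distrl /=.
pose hit p j := box j == encode p.1 p.2.
apply: (@leq_trans (\sum_(p | cand p) \sum_(j < k | hit p j) 1)).
  apply: leq_sum => p; rewrite /cand in_candidates mul1n.
  by case/andP=> _ /leq_trans; apply; rewrite sum1_card cardsE.
rewrite (exchange_big_dep xpredT) //= -[leqRHS]card_ord -sum1_card.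
apply: leq_sum => j _; rewrite sum1_card; apply/card_le1_eqP.
move=> [s A] [s' A']; rewrite !unfold_in /= /cand /hit /= !in_candidates.
move=> /andP[/andP[sA _] /eqP->] /andP[/andP[sA' _] /eqP].
by case/(encode_inj sA sA') => -> ->.
Qed.

(** A separating set is no larger than its family, so the total number of candidates bounds the
    union. *)
Lemma card_checked box : (0 < t)%N -> (#|checked box| <= k %/ t)%N.
Proof.
move=> t_gt0; rewrite leq_divRL //; apply: leq_trans (card_candidates box).
rewrite leq_mul2r; apply/orP; right.
apply: (big_ind2 (fun (D : {set 'I_n}) m => #|D| <= m)%N).
- by rewrite cards0.
- move=> D1 m1 D2 m2 le1 le2; apply: leq_trans (leq_add le1 le2).
  by rewrite cardsU leq_subr.
- by move=> s _; apply: card_separating_set.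
Qed.

(** The true string is itself a candidate, so any candidate agreeing with it on the separating set
    equals it. *)
Lemma reconstruct_checked box X :
    (forall s, X :&: segment s \in candidates box s) ->
  reconstruct box (X :&: checked box) = X.
Proof.
move=> candX; apply/setP => x; rewrite inE.
have meetD s : X :&: checked box :&: segment s
      :&: separating_set (candidates box s) =
    X :&: segment s :&: separating_set (candidates box s).
  have sub : separating_set (candidates box s) \subset checked box.
    exact: (bigcup_sup s).
  by rewrite -!setIA (setICA (checked box)) (setIidPr sub).
apply/existsP/idP => [[s /exists_inP[A cA /andP[xA]]]|xX].
  rewrite meetD => /eqP/(separating_setP cA (candX s)) eqA.
  by move: xA; rewrite eqA inE => /andP[].
have [s xs] := in_some_segment x; exists s.
apply/exists_inP; exists (X :&: segment s); first exact: candX.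
by rewrite meetD inE xX xs /=.
Qed.

Lemma ones_answer (X : n.-tuple bool) D :
  ones (answer X D) = [set x | tnth X x] :&: D.
Proof.
by apply/setP => x; rewrite !inE ffunE; case: (x \in D); case: (tnth X x).
Qed.

Lemma segment_protocol_queries (A : adversary n k r) (w : 2.-tuple (coins k r))
    (i : 'I_k) : (0 < t)%N ->
  (query_count (run segment_protocol A w) i
     <= (n %/ 2 ^ r).+1 + k %/ t)%N.
Proof.
move=> t_gt0; case: w => [[|c1 [|c2 []]]] //= _.
rewrite /query_count /run /= !big_cons big_nil addn0 /=.
apply: leq_add; case: ifP => _; rewrite ?cards0 //.
- exact: card_segment.
- exact: card_checked.
Qed.

Lemma segment_protocol_messages (A : adversary n k r) (w : 2.-tuple (coins k r)) :
  (max_message_size (run segment_protocol A w) <= r + (n %/ 2 ^ r).+1)%N.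
Proof.
case: w => [[|c1 [|c2 []]]] //= _.
rewrite /max_message_size /run /= !big_cons big_nil maxn0 geq_max /=.
apply/andP; split; apply/bigmax_leqP => i /negbTE iB; apply/bigmax_leqP => j _.
- by rewrite iB; case: ifP => // _; apply: size_encode.
- by rewrite iB; case: ifP.
Qed.

Lemma segment_protocol_downloads (A : adversary n k r) (c1 c2 : coins k r) :
    (forall s, (t < #|[set j in ~: corrupt A [::] | c1 j == s]|)%N) ->
  downloads segment_protocol A [:: c1; c2].
Proof.
move=> hits; apply/forallP => i; apply/implyP.
rewrite /nonfaulty_at_end /run /= => iB.
(* [i] is nonfaulty in the last round, so its memory of that round is genuine. *)
rewrite (negbTE iB) /=.
pose box j := traffic (play_round segment_protocol A [::] c1) j i.
rewrite -[fun j => if j == i then _ else _]/box ones_answer reconstruct_checked.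
  by apply/eqP/eq_from_tnth => x; rewrite tnth_mktuple inE.
move=> s; rewrite in_candidates subsetIr /=.
(* [i] may be one of the hits but delivers nothing to itself; the strict bound still leaves [t]
   copies. *)
have := hits s; rewrite (cardsD1 i) => /leq_trans lt_t; rewrite -ltnS.
apply: lt_t; rewrite -[leqRHS]add1n; apply: leq_add; first exact: leq_b1.
apply: subset_leq_card; apply/subsetP => j; rewrite !inE => /and3P[ji jB /eqP js].
by rewrite /box /= (negbTE ji) (negbTE jB) js ones_answer.
Qed.

End SegmentProtocol.

(** * Success probability *)

Section Probability.
Variables (R : realType) (n k r t : nat).

Lemma card_first_coins (E : {set coins k r}) :
  (#|[set w : 2.-tuple (coins k r) | thead w \in E]|
     <= #|E| * #|{: coins k r}|)%N.
Proof.
rewrite -[X in (_ <= _ * X)%N]cardsT -cardsX.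
pose f (w : 2.-tuple (coins k r)) := (thead w, tnth w ord_max).
rewrite -(card_imset _ (_ : injective f)).
  apply: subset_leq_card; apply/subsetP => p /imsetP[w wE ->].
  by move: wE; rewrite !inE => -> /=.
move=> u v; rewrite /f => -[eq0 eq1]; apply: eq_from_tnth => -[[|[|]]] // i2.
  by rewrite (_ : Ordinal i2 = ord0) //; apply: val_inj.
by rewrite (_ : Ordinal i2 = ord_max) //; apply: val_inj.
Qed.

(** Round 1 starts from the empty transcript, so its honest set [G] is fixed before the coins are
    drawn; [lower_tail] applies to each segment, then a union bound over segments. *)
Lemma segment_protocol_success (A : adversary n k r) :
  1 - (2 ^ r)%:R * (2 ^+ t * (1 - (2 * (2 ^ r)%:R)^-1)
        ^+ #|~: corrupt A [::]|)
    <= success_probability R 2 (segment_protocol n k r t) A.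
Proof.
set P := segment_protocol n k r t; set G := ~: _; set b := _ ^+ t * _.
pose E s := [set c1 : coins k r | #|[set j in G | c1 j == s]| <= t]%N.
set N := #|{: coins k r}|.
have cardE s : #|E s|%:R <= b * N%:R :> R.
  by have := lower_tail R G s t; rewrite card_coin.
rewrite /success_probability; set good := [set w | _].
have bad_sub : ~: good
    \subset \bigcup_s [set w : 2.-tuple (coins k r) | thead w \in E s].
  apply/subsetP => -[[|c1 [|c2 []]] // sz]; rewrite !inE /=.
  apply: contraR => noE; apply: segment_protocol_downloads => s.
  rewrite ltnNge; apply: contra noE => le_t.
  by apply/bigcupP; exists s; rewrite // !inE.
have Npos : 0 < N%:R :> R.
  by rewrite ltr0n; apply/card_gt0P; exists [ffun=> [tuple of nseq r false]].
have bad_le : #|~: good|%:R <= (2 ^ r)%:R * b * N%:R ^+ 2 :> R.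
  apply: (@le_trans _ _ (\sum_(s : coin r) (#|E s| * N)%:R)).
    rewrite -natr_sum ler_nat; apply: leq_trans (subset_leq_card bad_sub) _.
    apply: (big_ind2 (fun (D : {set 2.-tuple (coins k r)}) m => #|D| <= m)%N).
    - by rewrite cards0.
    - move=> D1 m1 D2 m2 le1 le2; apply: leq_trans (leq_add le1 le2).
      by rewrite cardsU leq_subr.
    - by move=> s _; apply: card_first_coins.
  apply: (@le_trans _ _ (\sum_(s : coin r) b * N%:R ^+ 2)).
    apply: ler_sum => s _; rewrite natrM expr2 mulrA.
    by rewrite ler_wpM2r // ltW.
  by rewrite sumr_const card_coin -[leLHS]mulr_natl mulrA.
have total : #|good|%:R + #|~: good|%:R = N%:R ^+ 2 :> R.
  by rewrite -natrD cardsC card_tuple natrX.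
have -> : #|{: 2.-tuple (coins k r)}|%:R = N%:R ^+ 2 :> R.
  by rewrite card_tuple natrX.
rewrite ler_pdivlMr ?exprn_gt0 //.
by rewrite mulrBl mul1r lerBlDr -[leLHS]total lerD2l.
Qed.

End Probability.

(** * Number of segments and vote threshold *)

Section ParameterChoice.
Variable R : realType.

Lemma powr2_le_expR t : 2 ^+ t <= expR t%:R :> R.
Proof.
rewrite -[t%:R]mulr1 expRM_natl lerXn2r ?nnegrE ?expR_ge0 //.
by apply: le_trans (expR_ge1Dx 1); rewrite -natr1.
Qed.

(** From ln (1 + x) <= x at x = -1/2. It yields (c + 1) ln n >= 1, hence a positive threshold. *)
Lemma ln2_ge_half : 2^-1 <= ln 2 :> R.
Proof.
have := @le_ln1Dx R (- 2^-1); rewrite (_ : 1 - 2^-1 = 2^-1); last by field.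
by rewrite lnV ?posrE // lerN2; apply; lra.
Qed.

(** After t > 0, the conjuncts control in turn the failure probability, the number of segments
    (hence the name length [r]), the segment length and the number of candidates. *)
Lemma segment_parameters (c gamma : R) (n k : nat) :
    1 <= c -> 0 < gamma -> gamma <= 1 -> (k <= n)%N -> (1 < n)%N ->
    4 * (c + 1) * ln n%:R <= gamma * k%:R ->
  exists r t : nat, [/\ (0 < t)%N,
    forall m : nat, gamma * k%:R <= m%:R ->
      (2 ^ r)%:R * (2 ^+ t * (1 - (2 * (2 ^ r)%:R)^-1) ^+ m)
        <= n%:R `^ (- c),
    (2 ^ r)%:R <= Num.sqrt (n%:R / gamma),
    n%:R / (2 ^ r)%:R <= 8 * (c + 1) * (n%:R * ln n%:R / (gamma * k%:R))
        + 2 * Num.sqrt (n%:R / gamma) &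
    k%:R / t%:R <= 8 * Num.sqrt (n%:R / gamma)].
Proof.
move=> c1 g0 g1 kn n1 hk.
set l := ln n%:R in hk *; set Q := Num.sqrt _.
have n2 : 2 <= n%:R :> R by rewrite ler_nat.
have knR : k%:R <= n%:R :> R by rewrite ler_nat.
have l_half : 2^-1 <= l.
  by apply: le_trans ln2_ge_half _; rewrite ler_ln ?posrE //; lra.
set L := 4 * (c + 1) in hk.
have Ll1 : 1 <= L * l by rewrite /L; nra.
have gk1 : 1 <= gamma * k%:R by apply: le_trans hk.
have Q2 : Q ^+ 2 = n%:R / gamma by rewrite sqr_sqrtr // divr_ge0 ?ltW //; lra.
have Q0 : 0 < Q by rewrite sqrtr_gt0 divr_gt0 //; lra.
have nQ : n%:R = gamma * Q ^+ 2 by rewrite Q2; field; rewrite gt_eqF.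
have gQ1 : 1 <= gamma * Q.
  have : 1 <= (gamma * Q) ^+ 2 by rewrite exprMn expr2 -mulrA -nQ; nra.
  by rewrite expr_ge1 // mulr_ge0 ?ltW.
(* [gamma * Q] is sqrt(n gamma); [M] is the ideal number of segments, and rounding it down to a
   power of two costs a factor 2. *)
pose M := Num.min (gamma * Q) (gamma * k%:R / (L * l)).
have M1 : 1 <= M.
  by rewrite /M le_min gQ1 ler_pdivlMr ?mul1r //; lra.
have [r [K_le lt_K]] : exists r, (2 ^ r)%:R <= M /\ M < 2 * (2 ^ r)%:R.
  have M_gt0 : (0 < Num.truncn M)%N by rewrite truncn_gt0.
  have /andP[lo hi] := trunc_log_bounds (isT : (1 < 2)%N) M_gt0.
  have M0 : 0 <= M by apply: le_trans M1.
  exists (trunc_log 2 (Num.truncn M)); split; first by rewrite -truncn_ge_nat.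
  by rewrite -natrM -expnS -truncn_lt_nat.
set K := (2 ^ r)%:R in K_le lt_K *.
have K1 : 1 <= K by rewrite /K ler1n expn_gt0.
have [K_Q K_k] : K <= gamma * Q /\ K <= gamma * k%:R / (L * l).
  by move: K_le; rewrite le_min => /andP[].
have Kk : K * (L * l) <= gamma * k%:R by rewrite -ler_pdivlMr //; lra.
(* The mean number of honest hits on a segment is at least gamma k / K; the threshold is a quarter
   of this, rounded down. *)
pose y := gamma * k%:R / (4 * K).
have yK : y * (4 * K) = gamma * k%:R by rewrite /y divfK // gt_eqF //; lra.
have y_ge : (c + 1) * l <= y.
  rewrite /y ler_pdivlMr; last lra.
  by apply: le_trans Kk; rewrite /L; lra.
have y1 : 1 <= y by apply: le_trans y_ge; nra.
have [t_le lt_t] : (Num.truncn y)%:R <= y /\ y < (Num.truncn y).+1%:R.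
  by apply/andP; apply: truncn_itv; lra.
have t0 : (0 < Num.truncn y)%N by rewrite truncn_gt0.
exists r, (Num.truncn y); rewrite -/K; set t := Num.truncn y in t_le lt_t t0 *.
have t1 : 1 <= t%:R :> R by rewrite ler1n.
rewrite -natr1 in lt_t.
split=> //.
- move=> m mk.
  have K_n : K <= expR l by rewrite lnK ?posrE; [nra | lra].
  have base : 0 <= 1 - (2 * K)^-1 <= expR (- (2 * K)^-1).
    rewrite expR_ge1Dx andbT subr_ge0 invf_le1; lra.
  rewrite /powR gt_eqF; last lra.
  (* The factor n pays for the union over K <= n segments; the rest has to be at most n^-(c+1). *)
  have -> : - c * l = l + - ((c + 1) * l) by ring.
  rewrite expRD ler_pM ?mulr_ge0 ?exprn_ge0 //; try lra.
  apply: (@le_trans _ _ (expR t%:R * expR (- (2 * K)^-1) ^+ m)).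
    rewrite ler_pM ?exprn_ge0 ?powr2_le_expR //; try lra.
    by rewrite lerXn2r ?nnegrE //; lra.
  rewrite -expRM_natl -expRD ler_expR.
  (* As t <= y, the exponent t - m / (2 K) is then at most -y <= -(c + 1) ln n. *)
  have : y * 2 <= m%:R * (2 * K)^-1.
    by rewrite ler_pdivlMr; lra.
  lra.
- nra.
- rewrite ler_pdivrMr; last lra.
  set z := n%:R * l / _.
  have zE : z * (gamma * k%:R) = n%:R * l by rewrite divfK // gt_eqF //; lra.
  have z0 : 0 <= z by rewrite divr_ge0 ?mulr_ge0 //; lra.
  clearbody z.
  (* One of the two terms of [M] is below 2 K: the first gives n / K <= 2 Q, the second n / K <= 2 L
     z. *)
  move: lt_K; rewrite gt_min => /orP[lt_K|].
    have : gamma * Q * Q <= 2 * K * Q by rewrite ler_wpM2r ?ltW.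
    have : 0 <= (c + 1) * z * K by rewrite !mulr_ge0 //; lra.
    rewrite nQ; lra.
  rewrite ltr_pdivrMr; last lra.
  move=> /ltW /(ler_wpM2l z0); rewrite zE.
  have -> : z * (2 * K * (L * l)) = 2 * L * z * K * l by ring.
  rewrite ler_pM2r; last lra.
  have : 0 <= Q * K by rewrite mulr_ge0 ?ltW //; lra.
  rewrite /L; lra.
- rewrite ler_pdivrMr; last lra.
  rewrite -(ler_pM2l g0) -yK.
  (* Since t >= 1, y < t + 1 <= 2 t. *)
  have : y * (4 * K) <= (2 * t%:R) * (4 * (gamma * Q)).
    by rewrite ler_pM //; lra.
  lra.
Qed.

End ParameterChoice.

(** * Querying the whole source *)

Section FullQuery.
Variables (R : realType) (n k : nat).

(* Peers query everything in the last round, so that no state carried over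
   from an earlier, possibly corrupted, round is used. *)
Definition full_query_protocol : protocol n k 0 := {|
  ask := fun _ v _ => if v is [::] then set0 else setT;
  send := fun _ _ _ _ _ => [::];
  decide := fun _ v => if v is [:: _; l]
    then [tuple own_answers l x == Some true | x < n]
    else [tuple of nseq n false] |}.

Lemma full_query_downloads (A : adversary n k 0) (w : 2.-tuple (coins k 0)) :
  downloads full_query_protocol A w.
Proof.
case: w => [[|c1 [|c2 []]]] //= _; apply/forallP => i; apply/implyP.
rewrite /nonfaulty_at_end /run /= => /negbTE ->.
apply/eqP/eq_from_tnth => x; rewrite tnth_mktuple ffunE inE.
by case: (tnth _ _).
Qed.

Lemma full_query_success (A : adversary n k 0) :
  success_probability R 2 full_query_protocol A = 1.
Proof.
rewrite /success_probability (_ : [set w | _] = setT).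
  by rewrite cardsT divff // pnatr_eq0 -lt0n; apply/card_gt0P;
     exists [tuple of nseq 2 [ffun=> [tuple of nseq 0 false]]].
by apply/setP => w; rewrite !inE full_query_downloads.
Qed.

Lemma full_query_queries (A : adversary n k 0) (w : 2.-tuple (coins k 0))
    (i : 'I_k) : (query_count (run full_query_protocol A w) i <= n)%N.
Proof.
case: w => [[|c1 [|c2 []]]] //= _.
rewrite /query_count /run /= !big_cons big_nil addn0 /=.
by do 2![case: ifP => _]; rewrite ?cards0 ?cardsT ?card_ord.
Qed.

Lemma full_query_messages (A : adversary n k 0) (w : 2.-tuple (coins k 0)) :
  max_message_size (run full_query_protocol A w) = 0%N.
Proof.
apply/eqP; rewrite -leqn0; case: w => [[|c1 [|c2 []]]] //= _.
rewrite /max_message_size /run /= !big_cons big_nil maxn0 geq_max /=.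
by apply/andP; split; apply/bigmax_leqP => i /negbTE iB;
  apply/bigmax_leqP => j _; rewrite iB; case: ifP.
Qed.

End FullQuery.

(** * Combining the two protocols *)

Theorem theorem4p2 (R : realType) (c : R) (hc : 1 <= c) :
  exists C : R, 0 < C /\
    forall (n k : nat) (beta : R),
      (0 < k)%N -> (k <= n)%N -> 0 <= beta -> beta < 1 ->
      let gamma := 1 - beta in
      exists (r : nat) (P : protocol n k r),
        (forall A : adversary n k r, admissible beta A ->
           1 - n%:R `^ (- c) <= success_probability R 2 P A) /\
        query_complexity_at_most 2 beta P
          (C * (n%:R * ln n%:R / (gamma * k%:R) + Num.sqrt (n%:R / gamma))) /\
        message_size_at_most 2 beta P
          (C * (n%:R / (gamma * k%:R) * ln n%:R + Num.sqrt (n%:R / gamma))).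
Proof.
(* The segment length gives 8 (c + 1) z + 2 Q, its rounding up 1 <= Q, and the candidates 8 Q; 11 =
   2 + 1 + 8. *)
exists (8 * (c + 1) + 11); split; first lra.
move=> n k beta k_gt0 le_kn b0 b1 gamma.
have g0 : 0 < gamma by rewrite /gamma; lra.
have g1 : gamma <= 1 by rewrite /gamma; lra.
have n1 : 1 <= n%:R :> R by rewrite ler1n (leq_trans k_gt0).
have k0 : 0 < k%:R :> R by rewrite ltr0n.
rewrite (mulrAC n%:R (_^-1)); set z := n%:R * ln n%:R / _; set Q := Num.sqrt _.
have z0 : 0 <= z by rewrite divr_ge0 ?mulr_ge0 ?ln_ge0 // ltW.
have Q1 : 1 <= Q.
  by rewrite -[leLHS]sqrtr1 ler_wsqrtr // ler_pdivlMr // mul1r; lra.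
have bound y : y <= 8 * (c + 1) * z + 11 * Q ->
    y <= (8 * (c + 1) + 11) * (z + Q).
  have : 0 <= (c + 1) * Q by rewrite mulr_ge0 //; lra.
  lra.
have [few|many] : n%:R <= 8 * (c + 1) * z + Q \/
    (1 < n)%N /\ 4 * (c + 1) * ln n%:R <= gamma * k%:R.
  (* For n = 1, ln n = 0 and only Q >= 1 can pay for the query. *)
  have [n_le1|n_gt1] := leqP n 1.
    left; have : n%:R <= 1 :> R by rewrite (ler_nat _ n 1).
    have : 0 <= (c + 1) * z by rewrite mulr_ge0 //; lra.
    lra.
  have [hk|/ltW hk] := lerP (4 * (c + 1) * ln n%:R) (gamma * k%:R).
    by right.
  left; have gk0 : 0 < gamma * k%:R by rewrite mulr_gt0.
  have : n%:R <= 4 * (c + 1) * z.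
    rewrite -(ler_pM2r gk0) -[leRHS]mulrA divfK ?gt_eqF // [leRHS]mulrCA.
    by rewrite ler_wpM2l //; lra.
  have : 0 <= (c + 1) * z by rewrite mulr_ge0 //; lra.
  lra.
- exists 0%N, (full_query_protocol n k); split=> [A _|].
    by rewrite full_query_success gerBl powR_ge0.
  have cz0 : 0 <= (c + 1) * z by rewrite mulr_ge0 //; lra.
  split=> [A _ w i|A _ w]; apply: bound; last first.
    by rewrite full_query_messages; lra.
  have : (query_count (run (full_query_protocol n k) A w) i)%:R <= n%:R :> R.
    by rewrite ler_nat full_query_queries.
  lra.
case: many => n_gt1 hk.
have [r [t [t0 fail KQ nK kt]]] := segment_parameters hc g0 g1 le_kn n_gt1 hk.
have segK : ((n %/ 2 ^ r).+1)%:R <= n%:R / (2 ^ r)%:R + 1 :> R.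
  rewrite -natr1 lerD2r ler_pdivlMr ?ltr0n ?expn_gt0 //.
  by rewrite -natrM ler_nat leq_divM.
exists r, (segment_protocol n k r t); split=> [A admA|].
  apply: le_trans (segment_protocol_success R t A).
  rewrite lerB //; apply: fail.
  (* At least k - beta k = gamma k peers are honest in round 1. *)
  rewrite -(@lerD2l _ #|corrupt A [::]|%:R) -natrD cardsC card_ord.
  have := admA [::]; rewrite /gamma; lra.
rewrite -/z -/Q in nK KQ kt.
split=> [A _ w i|A _ w]; apply: bound.
  have : (query_count (run (segment_protocol n k r t) A w) i)%:R
      <= (n %/ 2 ^ r).+1%:R + (k %/ t)%:R :> R.
    by rewrite -natrD ler_nat segment_protocol_queries.
  have : (k %/ t)%:R <= k%:R / t%:R :> R.
    by rewrite ler_pdivlMr ?ltr0n // -natrM ler_nat leq_divM.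
  lra.
have : (max_message_size (run (segment_protocol n k r t) A w))%:R
    <= r%:R + (n %/ 2 ^ r).+1%:R :> R.
  by rewrite -natrD ler_nat segment_protocol_messages.
(* The segment name costs r < 2^r <= Q bits. *)
have : r%:R <= (2 ^ r)%:R :> R by rewrite ler_nat ltnW // ltn_expl.
lra.
Qed.
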